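(* Let $\mathbb{P}$ be a partition of $\Omega$, let $\underline P$ be a W-coherent (respectively C-convex) lower probability on $\mathcal{A}_C(\mathbb{P})$, and let $C|D$ be a conditional event with $C|D\neq\varnothing|D$ and $C|D\ne D|D$. Then the extension of $\underline P$ to $\mathcal{A}_C(\mathbb{P})\cup\{C|D\}$ given by $\underline P(C|D)=\underline P((C|D)^* )$ is the (unique) upper extension of $\underline P$ to $\mathcal{A}_C(\mathbb{P})\cup\{C|D\}$.
   Context: Events are subsets of a nonempty set $\Omega$ (the sure event); $\wedge,\vee,\neg$ denote intersection, union, complement; $\Rightarrow$ denotes inclusion; an event is identified with its indicator function. For an event $B\neq\varnothing$ and a bounded function (gamble) $X:\Omega\to\mathbb{R}$, the conditional gamble $X|B$ is the restriction of $X$ to $B$ (so two conditional gambles with the same $B$ and the same restriction are identified); $\sup(X|B)=\sup_{\omega\in B}X(\omega)$. A conditional event $A|B$ ($B\ne\varnothing$) is the conditional gamble $I_A|B$; in particular $A|B=A\wedge B|B$. A map $\underline P:\mathcal{S}\to\mathbb{R}$ (lower prevision) on a set $\mathcal{S}$ of conditional gambles is W-coherent iff for all $n\in\mathbb{N}$, all $X_0|B_0,\dots,X_n|B_n\in\mathcal{S}$ and all real $s_0,\dots,s_n\ge 0$, setting $B=\bigvee_{i=0}^n B_i$ and $\underline G=\sum_{i=1}^n s_iB_i(X_i-\underline P(X_i|B_i))-s_0B_0(X_0-\underline P(X_0|B_0))$, one has $\sup(\underline G|B)\ge 0$. It is convex iff the same condition is required only for stakes with $\sum_{i=1}^n s_i=s_0>0$;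 it is C-convex (centered convex) iff it is convex and $X|B\in\mathcal{S}$ implies $0|B\in\mathcal{S}$ and $\underline P(0|B)=0$. It is called a lower probability when all elements of $\mathcal{S}$ are conditional events. Convention for C-convexity of extensions: when the assessment is extended to $C|D$, the event $\varnothing|D$ (i.e. $0|D$), if not already present, is understood to be adjoined to the domain with value $0$. An upper extension of a W-coherent (respectively C-convex) $\underline P$ to a larger domain is a W-coherent (respectively C-convex) extension $\underline U$ of $\underline P$ such that no other W-coherent (respectively C-convex) extension $\underline Q$ of $\underline P$ to that domain satisfies $\underline Q\ge\underline U$. A partition $\mathbb{P}$ is a set of pairwise disjoint nonempty events with union $\Omega$; $\mathcal{A}(\mathbb{P})$ is the set of all unions of elements of $\mathbb{P}$; $\mathcal{A}_C(\mathbb{P})=\{A|B: A,B\in\mathcal{A}(\mathbb{P}),\,B\ne\varnothing\}$. For an event $E$: $E_*=\bigvee_{e\in\mathbb{P}:\,e\Rightarrow E}e$ and $E^*=\bigvee_{e\in\mathbb{P}:\,e\wedge E\ne\varnothing}e$. For $C|D$ with $C|D\neq\varnothing|D$, $C|D\ne D|D$: $(C|D)^*=(C\wedge D)^*\,|\,[(C\wedge D)^*\vee(\neg C\wedge D)_*]$, which belongs to $\mathcal{A}_C(\mathbb{P})$. *)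

(* Defs.v *)
From mathcomp Require Import all_boot all_order all_algebra.
From mathcomp Require Import all_classical all_reals all_analysis.

Set Implicit Arguments.
Unset Strict Implicit.
Unset Printing Implicit Defensive.

Import Order.TTheory GRing.Theory Num.Theory.
Import numFieldNormedType.Exports.

Local Open Scope classical_set_scope.
Local Open Scope ring_scope.

(* The conditional gamble X|B is encoded by B and by the function equal to X on
   B and to 0 elsewhere.  As all conditional gambles are built with [cgamb],
   Leibniz equality of X|B and Y|C means that B = C and that X and Y agree
   on B. *)
Record cgamble (R : realType) (Omega : Type) := CGamble {
  cond : set Omega ;
  value : Omega -> R }.

Definition cgamb (R : realType) (Omega : Type) (X : Omega -> R)
    (B : set Omega) : cgamble R Omega :=
  CGamble B (patch (fun=> 0) B X).

Definition cevent (R : realType) (Omega : Type) (A B : set Omega) :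
    cgamble R Omega :=
  cgamb \1_A B.

Definition cgambles (R : realType) (Omega : Type) : set (cgamble R Omega) :=
  [set g | exists X B, [/\ bounded_fun X, B !=set0 & g = cgamb X B]].

Definition cevents (R : realType) (Omega : Type) : set (cgamble R Omega) :=
  [set g | exists A B, B !=set0 /\ g = cevent R A B].

Arguments cgambles R Omega : clear implicits.
Arguments cevents R Omega : clear implicits.

Section Coherence.
Context {R : realType} {Omega : Type}.

(* A lower prevision on S is a function P on all of [cgamble R Omega] whose
   values outside S are irrelevant. *)
Implicit Types (S T : set (cgamble R Omega)) (P Q U : cgamble R Omega -> R).

Definition term P (g : cgamble R Omega) (w : Omega) : R :=
  \1_(cond g) w * (value g w - P g).

Definition gain P n (g : 'I_n.+1 -> cgamble R Omega) (s : 'I_n.+1 -> R)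
    (w : Omega) : R :=
  \sum_(i < n.+1 | i != ord0) s i * term P (g i) w
  - s ord0 * term P (g ord0) w.

(* The set whose [sup] is taken is nonempty and bounded, because S contains
   only conditional gambles; [sup] is then the actual supremum. *)
Definition sup_gain P n (g : 'I_n.+1 -> cgamble R Omega) (s : 'I_n.+1 -> R) :
    R :=
  sup (gain P g s @` \bigcup_i cond (g i)).

Definition Wcoherent S P : Prop :=
  S `<=` cgambles R Omega /\
  forall n (g : 'I_n.+1 -> cgamble R Omega) (s : 'I_n.+1 -> R),
    (forall i, S (g i)) -> (forall i, 0 <= s i) ->
    0 <= sup_gain P g s.

Definition convex_prevision S P : Prop :=
  S `<=` cgambles R Omega /\
  forall n (g : 'I_n.+1 -> cgamble R Omega) (s : 'I_n.+1 -> R),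
    (forall i, S (g i)) -> (forall i, 0 <= s i) ->
    \sum_(i < n.+1 | i != ord0) s i = s ord0 -> 0 < s ord0 ->
    0 <= sup_gain P g s.

Definition Cconvex S P : Prop :=
  convex_prevision S P /\
  forall (X : Omega -> R) (B : set Omega), S (cgamb X B) ->
    S (cgamb (fun=> 0) B) /\ P (cgamb (fun=> 0) B) = 0.

Definition extends S P Q : Prop := forall g, S g -> Q g = P g.

(* K is the consistency notion: [Wcoherent] or [Cconvex]. *)
Definition upper_extension (K : set (cgamble R Omega) ->
      (cgamble R Omega -> R) -> Prop) S P T U : Prop :=
  [/\ S `<=` T, K T U, extends S P U &
      forall Q, K T Q -> extends S P Q -> (forall g, T g -> U g <= Q g) ->
        forall g, T g -> Q g = U g].

Definition unique_upper_extension (K : set (cgamble R Omega) ->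
      (cgamble R Omega -> R) -> Prop) S P T U : Prop :=
  upper_extension K S P T U /\
  forall U', upper_extension K S P T U' -> forall g, T g -> U' g = U g.

Definition assign P (h : cgamble R Omega) (p : R) : cgamble R Omega -> R :=
  fun g => if `[< g = h >] then p else P g.

End Coherence.

Section Partition.
Context {Omega : Type}.
Implicit Types (PP : set (set Omega)) (E C D : set Omega).

Definition algebra_of PP : set (set Omega) :=
  [set \bigcup_(e in Q) e | Q in [set Q | Q `<=` PP]].

Definition cevents_of (R : realType) PP : set (cgamble R Omega) :=
  [set g | exists A B, [/\ algebra_of PP A, algebra_of PP B, B !=set0 &
                          g = cevent R A B]].
Arguments cevents_of R PP : clear implicits.

Definition inner PP E : set Omega :=
  \bigcup_(e in [set e | PP e /\ e `<=` E]) e.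

Definition outer PP E : set Omega :=
  \bigcup_(e in [set e | PP e /\ e `&` E !=set0]) e.

Definition cevent_outer (R : realType) PP C D : cgamble R Omega :=
  cevent R (outer PP (C `&` D))
           (outer PP (C `&` D) `|` inner PP (~` C `&` D)).

Lemma cevents_of_sub (R : realType) PP :
  cevents_of R PP `<=` cevents R Omega.
Proof. by move=> g [A [B [_ _ B0 ->]]]; exists A, B. Qed.

End Partition.

Arguments cevents_of {Omega} R PP.

(* Main.v *)
(* Write (C|D)^* = C'|D'.  Every atom e contains a point v with v in D iff
   e is in D', and v in C /\ D iff e is in C'.  The other events
   are constant on e, so a gain involving C|D takes at v the value on e of the
   gain obtained by replacing C|D with C'|D', with the same price.  Hence the
   supremum of the first gain dominates that of the second one, and the
   extension is coherent.  It is the greatest one because C|D precedes C'|D'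
   in the Goodman-Nguyen order, for which every convex probability with values
   in [0, 1] is monotone. *)
Require Import Defs.
From mathcomp Require Import all_boot all_order all_algebra.
From mathcomp Require Import all_classical all_reals all_analysis.
From mathcomp Require Import lra.

Set Implicit Arguments.
Unset Strict Implicit.
Unset Printing Implicit Defensive.

Import Order.TTheory GRing.Theory Num.Theory.

Local Open Scope classical_set_scope.
Local Open Scope ring_scope.

(** * Conditional events and the terms of a gain *)

Section LowerPrevisions.
Context {R : realType} {Omega : Type}.
Implicit Types (S T : set (cgamble R Omega)) (P Q U : cgamble R Omega -> R).
Implicit Types (A B C D : set Omega).

Lemma cevents_cgambles : cevents R Omega `<=` cgambles R Omega.
Proof.
move=> _ [A [B [B0 ->]]]; exists \1_A, B; split=> //.
exists 1; split=> [|M M1 w _]; first exact: num_real.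
by rewrite /= indicE normr_nat (le_trans _ (ltW M1)) // lern1 leq_b1.
Qed.

Lemma cevent0E D : cevent R set0 D = cgamb (fun=> 0) D.
Proof. by rewrite /cevent indic0. Qed.

Lemma cevent_disjoint C D : C `&` D = set0 -> cevent R C D = cevent R set0 D.
Proof.
move=> CD0; congr CGamble; apply/funext => w; rewrite /patch !indicE in_set0.
case: ifPn => // /set_mem Dw; rewrite memNset // => Cw.
by have : (C `&` D) w by []; rewrite CD0.
Qed.

Lemma eq_cevent A B A' B' :
  B = B' -> A `&` B = A' `&` B' -> cevent R A B = cevent R A' B'.
Proof.
move=> <- AB; congr CGamble; apply/funext => w; rewrite /patch.
case: ifPn => // /set_mem Bw; rewrite !indicE; congr ((nat_of_bool _)%:R).
by apply/idP/idP => /set_mem Aw; apply/mem_set;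
  [have [] : (A' `&` B) w by rewrite -AB | have [] : (A `&` B) w by rewrite AB].
Qed.

Lemma cevent_inj A B A' B' :
  cevent R A B = cevent R A' B' -> B = B' /\ A `&` B = A' `&` B'.
Proof.
move=> [-> e]; split=> //; apply/seteqP; split=> w [Aw Bw]; split=> //;
  have := congr1 (@^~ w) e; rewrite /patch /= (mem_set Bw) !indicE (mem_set Aw).
- by case: (boolP (w \in A')) => [/set_mem//|_ /eqP]; rewrite eqr_nat.
- by case: (boolP (w \in A)) => [/set_mem//|_ /eqP]; rewrite eqr_nat.
Qed.

Lemma term_cevent P A B w :
  term P (cevent R A B) w = \1_B w * (\1_A w - P (cevent R A B)).
Proof.
rewrite /term /= /patch !indicE.
by case: (boolP (w \in B)) => _; rewrite ?mul0r.
Qed.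

(** A term vanishes off its conditioning event, so membership in [A] and [A'] has to agree only at
    points of [B]. *)
Lemma eq_term_cevent P U A B A' B' w w' :
    (B w <-> B' w') -> (B w -> (A w <-> A' w')) ->
    U (cevent R A B) = P (cevent R A' B') ->
  term U (cevent R A B) w = term P (cevent R A' B') w'.
Proof.
move=> eqB eqA eU; rewrite !term_cevent eU !indicE.
have -> : (w \in B) = (w' \in B') by apply/idP/idP => /set_mem/eqB/mem_set.
case: (boolP (w' \in B')) => [/set_mem/eqB/eqA {}eqA|_]; last by rewrite !mul0r.
by have -> : (w \in A) = (w' \in A') by apply/idP/idP => /set_mem/eqA/mem_set.
Qed.

Lemma term_cevent_le P A B w :
  `|term P (cevent R A B) w| <= 1 + `|P (cevent R A B)|.
Proof.
rewrite term_cevent normrM !indicE normr_nat.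
apply: le_trans (_ : `|(w \in A)%:R - P (cevent R A B)| <= _).
  by rewrite ler_piMl // lern1 leq_b1.
by rewrite (le_trans (ler_normB _ _)) // lerD2r normr_nat lern1 leq_b1.
Qed.

(** Needed because [sup] falls back to a default value on sets unbounded above. An indicator is at
    most 1, so the bets are bounded one by one. *)
Lemma gain_has_ubound P n (g : 'I_n.+1 -> cgamble R Omega)
    (s : 'I_n.+1 -> R) (E : set Omega) :
  (forall i, cevents R Omega (g i)) -> has_ubound (gain P g s @` E).
Proof.
move=> gE; have sg i w : `|s i * term P (g i) w| <= `|s i| * (1 + `|P (g i)|).
  rewrite normrM ler_wpM2l //; have [A [B [_ ->]]] := gE i.
  exact: term_cevent_le.
exists (\sum_(i < n.+1 | i != ord0) `|s i| * (1 + `|P (g i)|)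
        + `|s ord0| * (1 + `|P (g ord0)|)) => _ [w _ <-].
apply: lerD; last by rewrite (le_trans (ler_norm _)) // normrN.
by apply: ler_sum => i _; rewrite (le_trans (ler_norm _)).
Qed.

(** * Transfer of coherence along a map of points *)

Section Transfer.
Variables (S T : set (cgamble R Omega)) (P U : cgamble R Omega -> R).
Variable phi : Omega -> Omega.
Hypothesis T_cevents : T `<=` cevents R Omega.
Hypothesis T_S : forall g, T g -> exists h, [/\ S h,
  forall w, cond h w -> cond g (phi w) &
  forall w, term U g (phi w) = term P h w].

(** The gain under [U] at [phi w] equals the gain of the matching bets under [P] at [w]. So every
    value of the latter gain is a value of the former, and the suprema compare. Stakes are
    untouched, hence any condition on them carries over. *)
Lemma sup_gain_transfer n (g : 'I_n.+1 -> cgamble R Omega)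
    (s : 'I_n.+1 -> R) :
    S `<=` cgambles R Omega -> (forall i, T (g i)) ->
  exists2 h, forall i, S (h i) & sup_gain P h s <= sup_gain U g s.
Proof.
move=> S_cg gT; have [h hP] := choice (fun i => T_S (gT i)).
exists h => [i|]; first by case: (hP i).
have sub : gain P h s @` (\bigcup_i cond (h i)) `<=`
           gain U g s @` (\bigcup_i cond (g i)).
  move=> _ [w [i _ hw] <-]; exists (phi w).
    by exists i => //; case: (hP i) => _ + _; apply.
  rewrite /gain; congr (_ - _); last by case: (hP ord0) => _ _ ->.
  by apply: eq_bigr => i0 _; case: (hP i0) => _ _ ->.
have ne : gain P h s @` (\bigcup_i cond (h i)) !=set0.
  have [Sh _ _] := hP ord0; have [X [B [_ [w Bw] hE]]] := S_cg _ Sh.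
  by exists (gain P h s w), w => //; exists ord0; rewrite // hE.
apply: sup_le => //.
  by move=> x /sub gx; apply/downP; exists x.
split; first by case: ne => x /sub; exists x.
by apply: gain_has_ubound => i; exact/T_cevents/gT.
Qed.

Lemma Wcoherent_transfer : Wcoherent S P -> Wcoherent T U.
Proof.
move=> [S_cg coh]; split=> [|n g s gT s0].
  exact: subset_trans cevents_cgambles.
have [h hS] := sup_gain_transfer s S_cg gT.
by apply: le_trans; exact: coh.
Qed.

Lemma convex_transfer : convex_prevision S P -> convex_prevision T U.
Proof.
move=> [S_cg coh]; split=> [|n g s gT s0 s1 s00].
  exact: subset_trans cevents_cgambles.
have [h hS] := sup_gain_transfer s S_cg gT.
by apply: le_trans; exact: coh.
Qed.

End Transfer.

(** * Inequalities obtained from two bets *)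

Definition pair2 (X : Type) (x0 x1 : X) (i : 'I_2) : X :=
  if i == ord0 then x0 else x1.

Lemma pair_sup_gain_le P (h0 h1 : cgamble R Omega) (a0 a1 c : R) :
    cond h0 !=set0 ->
    (forall w, cond h0 w \/ cond h1 w ->
       a1 * term P h1 w - a0 * term P h0 w <= c) ->
  sup_gain P (pair2 h0 h1) (pair2 a0 a1) <= c.
Proof.
move=> [w0 h0w] le_c; apply: ge_sup.
  by exists (gain P (pair2 h0 h1) (pair2 a0 a1) w0), w0 => //; exists ord0.
move=> _ [w [i _ iw] <-].
rewrite /gain big_mkcond !big_ord_recl big_ord0 /= add0r addr0.
by apply: le_c; move: iw; rewrite /pair2; case: ifP => _; [left|right].
Qed.

Lemma Wcoherent_convex T Q : Wcoherent T Q -> convex_prevision T Q.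
Proof. by move=> [TE coh]; split=> // n g s gT s0 _ _; exact: coh. Qed.

(** Stakes 1 and 1 meet the convexity constraint; the bet at [ord0] is the one that [gain]
    subtracts. An inequality is then proved by taking for [c] the quantity that has to be
    nonnegative. *)
Lemma convex_pair T Q h0 h1 (c : R) :
    convex_prevision T Q -> T h0 -> T h1 ->
    (forall w, cond h0 w \/ cond h1 w -> term Q h1 w - term Q h0 w <= c) ->
  0 <= c.
Proof.
move=> [T_cg coh] Th0 Th1 le_c.
apply: le_trans (_ : sup_gain Q (pair2 h0 h1) (pair2 1 1) <= _).
  apply: coh => [i|i||]; rewrite /pair2 //; first by case: ifP.
  - by case: ifP.
  - by rewrite big_mkcond !big_ord_recl big_ord0 /= add0r addr0.
apply: pair_sup_gain_le => [|w hw]; last by rewrite !mul1r le_c.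
by have [X [B [_ [w Bw] ->]]] := T_cg _ Th0; exists w.
Qed.

(** Stakes 1, 0 leave only the bet against [A|B], whose gain is at most its price; stakes 0, 1 leave
    only the bet on it, whose gain is at most 1 minus the price. *)
Lemma Wcoherent_bounds T Q A B : Wcoherent T Q -> T (cevent R A B) ->
  0 <= Q (cevent R A B) <= 1.
Proof.
move=> [T_cg coh] TAB; set g := cevent R A B in TAB *.
have B0 : cond g !=set0 by have [X [B' [_ [w Bw] ->]]] := T_cg _ TAB; exists w.
have coh2 a0 a1 : 0 <= a0 -> 0 <= a1 ->
    0 <= sup_gain Q (pair2 g g) (pair2 a0 a1).
  by move=> a00 a10; apply: coh => i; rewrite /pair2; case: ifP.
have termE w : cond g w \/ cond g w -> term Q g w = \1_A w - Q g.
  move=> gw; have {}gw : B w by case: gw.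
  by rewrite term_cevent indicE mem_set // mul1r.
have A01 w : 0 <= \1_A w :> R by rewrite indicE.
have A11 w : \1_A w <= 1 :> R by rewrite indicE lern1 leq_b1.
apply/andP; split.
- apply: le_trans (coh2 1 0 ler01 (lexx _)) _.
  apply: pair_sup_gain_le => // w /termE ->; have := A01 w; lra.
- rewrite -subr_ge0; apply: le_trans (coh2 0 1 (lexx _) ler01) _.
  apply: pair_sup_gain_le => // w /termE ->; have := A11 w; lra.
Qed.

(** Convexity forbids a zero stake on one side only. Centering supplies [0|B] with price 0, whose
    term vanishes, and this serves as the idle bet. *)
Lemma Cconvex_bounds T Q A B : Cconvex T Q -> T (cevent R A B) ->
  0 <= Q (cevent R A B) <= 1.
Proof.
move=> [cvx ctr] TAB; have [T0B Q0B] := ctr _ _ TAB.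
rewrite -cevent0E in T0B Q0B.
have termE w : cond (cevent R A B) w \/ cond (cevent R A B) w ->
    term Q (cevent R A B) w = \1_A w - Q (cevent R A B).
  move=> Bw; have {}Bw : B w by case: Bw.
  by rewrite term_cevent indicE mem_set // mul1r.
have term0 w : term Q (cevent R set0 B) w = 0.
  by rewrite term_cevent Q0B indic0 subrr mulr0.
have A01 w : 0 <= \1_A w :> R by rewrite indicE.
have A11 w : \1_A w <= 1 :> R by rewrite indicE lern1 leq_b1.
apply/andP; split.
- apply: (convex_pair cvx TAB T0B) => w /termE ->; rewrite term0.
  have := A01 w; lra.
- rewrite -subr_ge0; apply: (convex_pair cvx T0B TAB) => w /termE ->.
  rewrite term0; have := A11 w; lra.
Qed.

(* The hypotheses on events say that A|B precedes C|D in the Goodman-Nguyen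
   order. *)
Lemma convex_le_cevent T Q A B C D :
    convex_prevision T Q -> T (cevent R A B) -> T (cevent R C D) ->
    Q (cevent R A B) <= 1 -> 0 <= Q (cevent R C D) <= 1 ->
    A `&` B `<=` C `&` D -> ~` C `&` D `<=` ~` A `&` B ->
  Q (cevent R A B) <= Q (cevent R C D).
Proof.
move=> cvx TAB TCD p1 /andP[q0 q1] AC CA.
set p := Q (cevent R A B) in p1 *; set q := Q (cevent R C D) in q0 q1 *.
(* The gain is at most [q - p] where both events are active, equals [- p] where only [B] holds (then
   [A] fails), and [q - 1] where only [D] holds (then [C] holds). Whichever bound is nonnegative,
   [p <= q] follows from the bounds on [p] and [q]. *)
have : 0 <= Num.max (q - p) (Num.max (- p) (q - 1)).
  apply: (convex_pair cvx TCD TAB) => w /= DB; rewrite !term_cevent -/p -/q.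
  rewrite !indicE !le_max.
  have [Aw|Aw] := boolP (w \in A); have [Bw|Bw] := boolP (w \in B);
  have [Cw|Cw] := boolP (w \in C); have [Dw|Dw] := boolP (w \in D);
  try (by exfalso; move: Aw Bw Cw Dw DB (AC w) (CA w);
          rewrite !(inE, notin_setE) /setI /setC /=; tauto);
  by apply/or3P; rewrite /= ?mulr1n ?mulr0n;
    first [constructor 1; lra | constructor 2; lra | constructor 3; lra].
by rewrite !le_max => /or3P[]; lra.
Qed.

End LowerPrevisions.

(** * Atoms of the partition and their representatives *)

Section Atoms.
Context {Omega : Type} {PP : set (set Omega)}.
Hypothesis PP_part : partition PP id [set: Omega].
Implicit Types (A B C D E e : set Omega).

Lemma atom_ex w : exists2 e, PP e & e w.
Proof.
have [PPT _ _] := PP_part; have : [set: Omega] w by [].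
by rewrite -PPT => -[e]; exists e.
Qed.

Lemma atom_eq e e' w : PP e -> PP e' -> e w -> e' w -> e = e'.
Proof.
by have [_ tr _] := PP_part => Pe Pe' ew e'w; apply: (tr e e') => //; exists w.
Qed.

Lemma algebra_atom A e w w' :
  algebra_of PP A -> PP e -> e w -> e w' -> A w -> A w'.
Proof.
move=> [F FP <-] Pe ew ew' [e' Fe' e'w]; exists e' => //.
by rewrite -(atom_eq Pe (FP _ Fe') ew e'w).
Qed.

Lemma algebra_of0 : algebra_of PP set0.
Proof. by exists set0 => [//|]; rewrite bigcup_set0. Qed.

Lemma algebra_outer E : algebra_of PP (outer PP E).
Proof. by exists [set e | PP e /\ e `&` E !=set0] => // e []. Qed.

Lemma algebra_inner E : algebra_of PP (inner PP E).
Proof. by exists [set e | PP e /\ e `<=` E] => // e []. Qed.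

Lemma algebra_setU A B :
  algebra_of PP A -> algebra_of PP B -> algebra_of PP (A `|` B).
Proof.
move=> [F FP <-] [G GP <-]; exists (F `|` G); last by rewrite bigcup_setU.
by move=> e [/FP|/GP].
Qed.

Lemma sub_outer E : E `<=` outer PP E.
Proof.
move=> w Ew; have [e Pe ew] := atom_ex w.
by exists e => //; split=> //; exists w.
Qed.

Lemma inner_sub E : inner PP E `<=` E.
Proof. by move=> w [e [_ eE] /eE]. Qed.

Lemma outer_atom E e w : PP e -> e w -> outer PP E w -> e `&` E !=set0.
Proof. by move=> Pe ew [e' [Pe' e'E] e'w]; rewrite (atom_eq Pe Pe' ew e'w). Qed.

Lemma inner_atom E e w : PP e -> e w -> inner PP E w -> e `<=` E.
Proof. by move=> Pe ew [e' [Pe' e'E] e'w]; rewrite (atom_eq Pe Pe' ew e'w). Qed.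

Lemma atom_representative C D : exists phi : Omega -> Omega, forall w,
  [/\ forall A, algebra_of PP A -> (A (phi w) <-> A w),
      D (phi w) <-> (outer PP (C `&` D) `|` inner PP (~` C `&` D)) w &
      (C `&` D) (phi w) <-> outer PP (C `&` D) w].
Proof.
suff /choice[phi phiP] : forall w, exists v,
    [/\ forall A, algebra_of PP A -> (A v <-> A w),
        D v <-> (outer PP (C `&` D) `|` inner PP (~` C `&` D)) w &
        (C `&` D) v <-> outer PP (C `&` D) w] by exists phi.
move=> w.
have [e Pe ew] := atom_ex w.
have alg v A : e v -> algebra_of PP A -> (A v <-> A w).
  by move=> ev algA; split; apply: (algebra_atom algA Pe).
have [[v [ev CDv]]|eCD] := pselect (e `&` (C `&` D) !=set0).
  have ow : outer PP (C `&` D) w by exists e => //; split=> //; exists v.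
  exists v; split=> [A algA||]; [exact: alg| |by []].
  by split=> _; [left|case: CDv].
have now : ~ outer PP (C `&` D) w by move/(outer_atom Pe ew).
have [eNCD|] := pselect (e `<=` ~` C `&` D).
  have [nCw Dw] := eNCD _ ew.
  exists w; split=> //; last by split=> // -[].
  by split=> // _; right; exists e.
move=> /existsNP[v /not_implyP[ev nCDv]].
have nDv : ~ D v.
  move=> Dv; apply: nCDv; split=> // Cv; apply: eCD; exists v; split=> //.
exists v; split=> [A algA||]; first exact: alg.
- split=> // -[//|/(inner_atom Pe ew)/(_ v ev)//].
- by split=> // -[].
Qed.

End Atoms.

(** * Reassigned values and greatest extensions *)

Section Assign.
Context {R : realType} {Omega : Type}.
Implicit Types (P : cgamble R Omega -> R) (g h : cgamble R Omega).

Lemma assign_eq P h p : assign P h p h = p.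
Proof. by rewrite /assign; case: asboolP. Qed.

Lemma assign_neq P h p g : g <> h -> assign P h p g = P g.
Proof. by rewrite /assign; case: asboolP. Qed.

(** An extension that dominates all the others is above any maximal one, which must therefore
    coincide with it; this yields uniqueness along with maximality. *)
Lemma greatest_upper_extension (K : set (cgamble R Omega) ->
      (cgamble R Omega -> R) -> Prop) (S T : set (cgamble R Omega)) P U :
    S `<=` T -> K T U -> extends S P U ->
    (forall Q, K T Q -> extends S P Q -> forall g, T g -> Q g <= U g) ->
  unique_upper_extension K S P T U.
Proof.
move=> ST KU PU maxU; split=> [|U' [_ KU' PU' maxU']].
  split=> // Q KQ PQ UQ g Tg.
  by apply: le_anti; rewrite maxU //= UQ.
move=> g Tg; apply/esym/maxU' => // h Th; exact: maxU.
Qed.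

End Assign.

(** * Upper extension to a single conditional event *)

Theorem proposition7 (R : realType) (Omega : Type)
    (Omega_neq0 : [set: Omega] !=set0)
    (PP : set (set Omega)) (PP_part : partition PP id [set: Omega])
    (P : cgamble R Omega -> R)
    (C D : set Omega) (D_neq0 : D !=set0)
    (CD_neq0 : cevent R C D <> cevent R set0 D)
    (CD_neqD : cevent R C D <> cevent R D D) :
  (Wcoherent (cevents_of R PP) P ->
     unique_upper_extension Wcoherent (cevents_of R PP) P
       (cevents_of R PP `|` [set cevent R C D])
       (assign P (cevent R C D) (P (cevent_outer R PP C D))))
  /\
  (Cconvex (cevents_of R PP) P ->
     unique_upper_extension Cconvex (cevents_of R PP) P
       (cevents_of R PP `|` [set cevent R C D; cevent R set0 D])
       (assign (assign P (cevent R set0 D) 0)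
          (cevent R C D) (P (cevent_outer R PP C D)))).
Proof.
set h := cevent R C D; set h0 := cevent R set0 D.
set hs := cevent_outer R PP C D; set S := cevents_of R PP.
set Ds := outer PP (C `&` D) `|` inner PP (~` C `&` D).
have CD : C `&` D !=set0.
  by apply/set0P/eqP => CD0; apply: CD_neq0; exact: cevent_disjoint.
have Ds0 : Ds !=set0 by case: CD => w CDw; exists w; left; exact: sub_outer.
have algDs : algebra_of PP Ds.
  exact: algebra_setU (algebra_outer _) (algebra_inner _).
have Shs : S hs.
  by exists (outer PP (C `&` D)), Ds; split=> //; exact: algebra_outer.
have [phi phiP] := atom_representative PP_part C D.
(* Old events do not distinguish [w] from [phi w], so each one is matched with itself. *)
have Sphi P' U g : S g -> U g = P' g -> exists g', [/\ S g',
    forall w, cond g' w -> cond g (phi w) &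
    forall w, term U g (phi w) = term P' g' w].
  move=> Sg Ug; exists g; split=> //; have [A [B [aA aB B0 gE]]] := Sg.
    by rewrite gE => w /=; have [/(_ _ aB)[]] := phiP w.
  rewrite gE in Ug *; move=> w; have [alg _ _] := phiP w.
  apply: eq_term_cevent => //; [exact: alg|move=> _; exact: alg].
have hphi U : U h = P hs -> exists g', [/\ S g',
    forall w, cond g' w -> cond h (phi w) &
    forall w, term U h (phi w) = term P g' w].
  move=> Uh; exists hs; split=> // w; have [_ eqD eqCD] := phiP w.
    by move=> /= /eqD.
  apply: eq_term_cevent => // Dw; rewrite -eqCD; split=> [|[]//].
  by split.
(* [C|D] may already belong to the domain. It then equals its outer event, since [phi] preserves
   membership in [D] and in [C]&[D], and [assign] does not alter its value. *)
have Sh_hs : S h -> h = hs.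
  move=> [A [B [aA aB B0 hE]]]; have [DB CDAB] := cevent_inj hE.
  apply: eq_cevent.
    apply/seteqP; split=> w; have [/(_ _ aB) + + _] := phiP w;
      by rewrite /= -/Ds DB; tauto.
  rewrite CDAB; apply/seteqP; split=> w;
    have [alg _] := phiP w; have := alg _ aB; have := alg _ aA;
    by rewrite CDAB /Ds /setI /setU /=; tauto.
have hs_max T Q : convex_prevision T Q -> T h -> T hs ->
    Q h <= 1 -> 0 <= Q hs <= 1 -> Q h <= Q hs.
  move=> cvx Th Ths Qh1 Qhs; apply: convex_le_cevent cvx Th Ths Qh1 Qhs _ _.
    by move=> w CDw; split; [|left]; exact: sub_outer.
  by move=> w [no [//|]]; exact: inner_sub.
split=> [W|Cc].
- apply: greatest_upper_extension.
  + by move=> g; left.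
  + apply: (Wcoherent_transfer (phi := phi) _ _ W).
    * move=> g [/cevents_of_sub//|->]; by exists C, D.
    * move=> g Tg; have [->|gh] := pselect (g = h).
        by apply: hphi; rewrite assign_eq.
      case: Tg => // Sg; apply: Sphi => //; exact: assign_neq.
  + move=> g Sg; have [gh|gh] := pselect (g = h); last exact: assign_neq.
    by rewrite gh assign_eq -Sh_hs // -gh.
  + move=> Q WQ PQ g Tg; have [->|gh] := pselect (g = h); last first.
      by case: Tg => // Sg; rewrite assign_neq // PQ.
    rewrite assign_eq -(PQ _ Shs).
    have Th : (S `|` [set h]) h by right.
    have Ths : (S `|` [set h]) hs by left.
    have cvxQ := Wcoherent_convex WQ.
    apply: (hs_max _ _ cvxQ Th Ths _ (Wcoherent_bounds WQ Ths)).
    by have /andP[] := Wcoherent_bounds WQ Th.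
- have [cvx ctr] := Cc.
  set T := S `|` _; set U := assign _ _ _.
  have Uh : U h = P hs by rewrite /U assign_eq.
  (* The outer [assign] does not overwrite this value because [C|D] differs from [set0|D]. *)
  have Uh0 : U h0 = 0.
    rewrite /U assign_neq ?assign_eq //; exact/nesym.
  have UP : extends S P U.
    move=> g Sg; have [gh|gh] := pselect (g = h).
      by rewrite gh Uh -Sh_hs // -gh.
    have [gh0|gh0] := pselect (g = h0); last first.
      by rewrite /U !assign_neq.
    (* If [set0|D] is already in the domain, centering gave it the value 0. *)
    rewrite gh0 Uh0 /h0 cevent0E; move: Sg; rewrite gh0 => /ctr[_ ->//].
  have P0 B : algebra_of PP B -> B !=set0 ->
      S (cevent R set0 B) /\ P (cevent R set0 B) = 0.
    move=> aB B0; have SB : S (cevent R set0 B).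
      by exists set0, B; split=> //; exact: algebra_of0.
    by split=> //; have [_] := ctr _ _ SB; rewrite cevent0E.
  apply: greatest_upper_extension => //.
  + by move=> g; left.
  + split.
    * apply: (convex_transfer (phi := phi) _ _ cvx).
        by move=> g [/cevents_of_sub//|[]->]; [exists C, D|exists set0, D].
      move=> g [Sg|[]->]; [exact/Sphi/UP|exact: hphi|].
      (* The adjoined [set0|D] is matched with [set0|Ds], which is in the old domain and also has
         price 0. *)
      have [S0 PS0] := P0 _ algDs Ds0.
      exists (cevent R set0 Ds); split=> // w; have [_ eqD _] := phiP w.
        by move=> /= /eqD.
      by apply: eq_term_cevent => //; rewrite PS0.
    * move=> X B TXB.
      suff [T0 U0] : T (cevent R set0 B) /\ U (cevent R set0 B) = 0.
        by rewrite -cevent0E.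
      case: TXB => [[A [B' [_ aB' B'0 [-> _]]]]|[[-> _]|[-> _]]].
      - by have [SB PB] := P0 _ aB' B'0; split; [left|rewrite UP].
      - by split=> //; right; right.
      - by split=> //; right; right.
  + move=> Q CQ PQ g Tg.
    have Th : T h by right; left.
    have Ths : T hs by left.
    case: Tg => [Sg|[]->]; first by rewrite PQ // UP.
      rewrite Uh -(PQ _ Shs).
      apply: (hs_max _ _ CQ.1 Th Ths _ (Cconvex_bounds CQ Ths)).
      by have /andP[] := Cconvex_bounds CQ Th.
    (* Centering of [Q], applied to [C|D], forces the value 0 on [set0|D]. *)
    by rewrite Uh0 /h0 cevent0E; have [_ ->] := CQ.2 _ _ Th.
Qed.
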